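(* Fix $m_3\in(0,1)$. Consider the equilibria $(\pm r_x^*,0,0)$ on the $x$-axis of the Hill four-body problem with oblate tertiary (see context). For $\mu\in(0,\tfrac12]$ and for the parameter $c$ negative and small enough (in absolute value), at these equilibria $\Omega_{zz}$ is negative, $A$ and $B$ are negative, and the value of the discriminant $D$ is always positive. Consequently, two pairs of eigenvalues of the linearization are purely imaginary, and one pair of eigenvalues is real (one positive and one negative). The linear stability is of center $\times$ center $\times$ saddle type.
   Context: The Hill four-body problem with oblate tertiary (rotated coordinates) is the system $\ddot x-2\dot y=\Omega_x$, $\ddot y+2\dot x=\Omega_y$, $\ddot z=\Omega_z$ with $$\Omega(x,y,z)=\tfrac12(\lambda_2x^2+\lambda_1y^2-z^2)+\frac1{r}-\frac{c}{r^3}+\frac{3cz^2}{r^5},\qquad r=(x^2+y^2+z^2)^{1/2},$$ where $\lambda_1=\tfrac32(1-d)$, $\lambda_2=\tfrac32(1+d)$, $d=\sqrt{1-v^2(4-v^2)(\mu-\mu^2)}$, $v=(1-3m_3^{2/3}c)^{-1/3}$; here $c=m_3^{-2/3}R_3^2C_{20}/2<0$ is the rescaled oblateness parameter of the body of mass $m_3$. The $x$-axis equilibria are $(\pm r_x^*,0,0)$, with $r_x^*>0$ the unique positive solution of $\lambda_2r^5-r^2+3c=0$. The linearization at such an equilibrium, in variables $(x,y,z,\dot x,\dot y,\dot z)$, has characteristic equation $(\rho^2-\Omega_{zz})(\rho^4+A\rho^2+B)=0$, where $A=4-\Omega_{xx}-\Omega_{yy}$, $B=\Omega_{xx}\Omega_{yy}$,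 and $D=A^2-4B$, all second derivatives being evaluated at the equilibrium. ''Center'' refers to a pair of nonzero purely imaginary eigenvalues, ''saddle'' to a pair of nonzero real eigenvalues of opposite signs. *)

(* Defs.v *)
From mathcomp Require Import all_boot all_order all_algebra.
From mathcomp Require Import all_classical all_reals all_analysis.
From mathcomp Require Import complex lra ring.

Set Implicit Arguments.
Unset Strict Implicit.
Unset Printing Implicit Defensive.

Import Order.TTheory GRing.Theory Num.Theory.
Import numFieldNormedType.Exports.

Local Open Scope ring_scope.

Definition hill_v (R : realType) (m3 c : R) : R :=
  (1 - 3 * m3 `^ (2 / 3) * c) `^ (- (1 / 3)).

Definition hill_d (R : realType) (m3 mu c : R) : R :=
  let v := hill_v m3 c in
  Num.sqrt (1 - v ^+ 2 * (4 - v ^+ 2) * (mu - mu ^+ 2)).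

Definition lambda1 (R : realType) (m3 mu c : R) : R :=
  3 / 2 * (1 - hill_d m3 mu c).

Definition lambda2 (R : realType) (m3 mu c : R) : R :=
  3 / 2 * (1 + hill_d m3 mu c).

Definition Omega (R : realType) (m3 mu c x y z : R) : R :=
  let r := Num.sqrt (x ^+ 2 + y ^+ 2 + z ^+ 2) in
  1 / 2 * (lambda2 m3 mu c * x ^+ 2 + lambda1 m3 mu c * y ^+ 2 - z ^+ 2)
    + 1 / r - c / r ^+ 3 + 3 * c * z ^+ 2 / r ^+ 5.

Definition dx (R : realType) (f : R -> R -> R -> R) (x y z : R) : R :=
  derive1 (fun t : R => f t y z) x.
Definition dy (R : realType) (f : R -> R -> R -> R) (x y z : R) : R :=
  derive1 (fun t : R => f x t z) y.
Definition dz (R : realType) (f : R -> R -> R -> R) (x y z : R) : R :=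
  derive1 (fun t : R => f x y t) z.

(* Right-hand side of the first-order form of the equations of motion; the
   coordinates 0, ..., 5 of a state are x, y, z and their velocities. *)
Definition hill_field (R : realType) (m3 mu c : R) (s : 'rV[R]_6) : 'rV[R]_6 :=
  let W := Omega m3 mu c in
  let x := s 0 0 in let y := s 0 1 in let z := s 0 2 in
  let vx := s 0 3 in let vy := s 0 4 in let vz := s 0 5 in
  \row_(i < 6) [:: vx; vy; vz;
                   dx W x y z + 2 * vy; dy W x y z - 2 * vx; dz W x y z]`_i.

Definition x_axis_state (R : realType) (x : R) : 'rV[R]_6 :=
  \row_(i < 6) (if i == 0 then x else 0).

(* The library's Jacobian acts on row vectors, so this is the transpose of the
   usual matrix of partial derivatives; it has the same eigenvalues. *)
Definition linearization (R : realType) (m3 mu c : R) (p : 'rV[R]_6) :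
  'M[R]_6 := jacobian (hill_field m3 mu c) p.

Definition rx_equation (R : realType) (m3 mu c r : R) : Prop :=
  lambda2 m3 mu c * r ^+ 5 - r ^+ 2 + 3 * c = 0.

Definition center_pair (R : realType) (a b : R[i]) : Prop :=
  exists2 w : R, w != 0 & a = (0 +i* w)%C /\ b = (0 +i* - w)%C.

Definition saddle_pair (R : realType) (a b : R[i]) : Prop :=
  exists s t : R, [/\ 0 < s, t < 0, a = (s +i* 0)%C & b = (t +i* 0)%C].

(* The complex eigenvalues are listed with algebraic multiplicity. *)
Definition center_center_saddle (R : realType) (M : 'M[R]_6) : Prop :=
  exists a1 b1 a2 b2 a3 b3 : R[i],
    [/\ char_poly (map_mx (real_complex R) M) =
          \prod_(rho <- [:: a1; b1; a2; b2; a3; b3]) ('X - rho%:P),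
        center_pair a1 b1, center_pair a2 b2 & saddle_pair a3 b3].

Lemma hill_d_ge0 (R : realType) (m3 mu c : R) : 0 <= hill_d m3 mu c.
Proof. exact: sqrtr_ge0. Qed.

Lemma rx_unique (R : realType) (m3 mu c : R) : c < 0 ->
  exists! r : R, 0 < r /\ rx_equation m3 mu c r.
Proof.
move=> c0; have d0 := hill_d_ge0 m3 mu c.
have l1 : 1 < lambda2 m3 mu c by rewrite /lambda2; lra.
rewrite /rx_equation; set l := lambda2 m3 mu c in l1 *.
have [b bE] : exists b : R, b = 1 - 3 * c by exists (1 - 3 * c).
have b1 : 1 < b by lra.
pose p : {poly R} := l *: 'X^5 - 'X^2 + (3 * c)%:P.
have pE x : p.[x] = l * x ^+ 5 - x ^+ 2 + 3 * c by rewrite /p !hornerE.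
have [||r /andP[r0 rb] /eqP] := @poly_ivt R p 0 b; first lra.
  rewrite !pE !expr0n /= mulr0 subr0 add0r; apply/andP; split; first lra.
  have b2 : b <= b ^+ 2 by rewrite ler_eXnr // ltW.
  have b5 : b ^+ 2 * b <= b ^+ 5.
    by rewrite -exprSr; apply: ler_weXn2l => //; exact: ltW.
  have b5' : b ^+ 5 <= l * b ^+ 5.
    by apply: ler_peMl; [apply: exprn_ge0; lra | exact: ltW].
  have : b ^+ 2 * 1 + (b - 1) <= b ^+ 2 * b by nra.
  by lra.
rewrite pE => rE; have {}r0 : 0 < r.
  rewrite lt_neqAle r0 andbT; apply/eqP => r00; move: rE.
  by rewrite -r00 !expr0n /= mulr0; lra.
exists r; split=> // s [s0 sE].
have key (u w : R) : 0 < u -> 0 < w -> u < w ->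
    l * u ^+ 5 - u ^+ 2 + 3 * c = 0 -> l * w ^+ 5 - w ^+ 2 + 3 * c = 0 -> False.
  move=> u0 w0 uw uE wE.
  have w2 : 0 < w ^+ 2 by rewrite exprn_gt0.
  have u2 : 0 < u ^+ 2 by rewrite exprn_gt0.
  have uw2 : u ^+ 2 < w ^+ 2 by rewrite ltrXn2r // ltW.
  have uw3 : u ^+ 3 < w ^+ 3 by rewrite ltrXn2r // ltW.
  have lu3 : 1 < l * u ^+ 3.
    rewrite -(ltr_pM2r u2) mul1r -mulrA -exprD; lra.
  have lw3 : l * u ^+ 3 < l * w ^+ 3 by rewrite ltr_pM2l //; lra.
  have : (l * u ^+ 3 - 1) * u ^+ 2 < (l * w ^+ 3 - 1) * w ^+ 2 by nra.
  have e (y : R) : (l * y ^+ 3 - 1) * y ^+ 2 = l * y ^+ 5 - y ^+ 2 by ring.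
  by rewrite !e; lra.
by case: (ltgtP r s) => // rs; [case: (key r s)|case: (key s r)].
Qed.

Lemma is_derive_Omega_slice (R : realType) (c t : R) (P Q Z : R -> R)
    (dP dQ dZ : R) :
  is_derive t 1 P dP -> is_derive t 1 Q dQ -> is_derive t 1 Z dZ -> 0 < Q t ->
  let r := Num.sqrt (Q t) in
  is_derive t 1
    (fun u => P u + 1 / Num.sqrt (Q u) - c / Num.sqrt (Q u) ^+ 3 +
              Z u / Num.sqrt (Q u) ^+ 5)
    (dP - dQ / (2 * r ^+ 3) + 3 * c * dQ / (2 * r ^+ 5) +
     dZ / r ^+ 5 - 5 * Z t * dQ / (2 * r ^+ 7)).
Proof.
move=> DP DQ DZ Q0 r.
have r0 : r != 0 by rewrite gt_eqF // sqrtr_gt0.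
have DS := is_derive1_comp (is_derive1_sqrt Q0) DQ.
pose I u := (Num.sqrt (Q u))^-1.
have DI : is_derive t 1 I (- r ^- 2 *: ((2 * r)^-1 * dQ)) by exact: is_deriveV.
have -> : (fun u => P u + 1 / Num.sqrt (Q u) - c / Num.sqrt (Q u) ^+ 3 +
              Z u / Num.sqrt (Q u) ^+ 5) =
          P + I - cst c * I ^+ 3 + Z * I ^+ 5.
  by apply/funext => u /=; rewrite !fctE /I !exprVn mul1r.
apply: is_derive_eq; rewrite !fctE /I -/r.
by rewrite /GRing.scale /=; field.
Qed.

Lemma hill_field_x_axis (R : realType) (m3 mu c r x : R) :
  0 < r -> rx_equation m3 mu c r -> x = r \/ x = - r ->
  hill_field m3 mu c (x_axis_state x) = 0.
Proof.
move=> r0 rE xr.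
have x0 : x != 0 by case: xr => ->; rewrite ?oppr_eq0 gt_eqF.
have x2 : x ^+ 2 = r ^+ 2 by case: xr => ->; rewrite ?sqrrN.
have r1 : r != 0 by rewrite gt_eqF.
set l2 := lambda2 m3 mu c; set l1 := lambda1 m3 mu c.
have sq (t : R) : is_derive t 1 (fun u : R => u ^+ 2) (2 * t).
  have -> : (fun u : R => u ^+ 2) = id ^+ 2 by apply/funext => u; rewrite fctE.
  by apply: is_derive_eq; rewrite /GRing.scale /= expr1 mulr1.
have lin (f : R -> R) (t df k m : R) : is_derive t 1 f df ->
    is_derive t 1 (fun u => k * f u + m) (k * df).
  move=> Df; have -> : (fun u => k * f u + m) = k \*: f + cst m by [].
  by apply: is_derive_eq; rewrite addr0.
have slice (F P Q Z : R -> R) (t dP dQ dZ : R) :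
    is_derive t 1 P dP -> is_derive t 1 Q dQ -> is_derive t 1 Z dZ ->
    Q t = r ^+ 2 ->
    F = (fun u => P u + 1 / Num.sqrt (Q u) - c / Num.sqrt (Q u) ^+ 3 +
              Z u / Num.sqrt (Q u) ^+ 5) ->
    dP - dQ / (2 * r ^+ 3) + 3 * c * dQ / (2 * r ^+ 5) +
     dZ / r ^+ 5 - 5 * Z t * dQ / (2 * r ^+ 7) = 0 ->
    derive1 F t = 0.
  move=> DP DQ DZ Qt -> e; rewrite derive1E.
  have Q0 : 0 < Q t by rewrite Qt exprn_gt0.
  have := is_derive_Omega_slice c DP DQ DZ Q0.
  by rewrite /= Qt sqrtr_sqr gtr0_norm // e => D; exact: derive_val.
have Dx : dx (Omega m3 mu c) x 0 0 = 0.
  apply: (slice _ _ _ _ _ _ _ _ (lin _ _ _ (1 / 2 * l2) 0 (sq x))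
            (lin _ _ _ 1 0 (sq x)) (lin _ _ _ 0 0 (sq x))).
  - by rewrite mul1r addr0.
  - apply/funext => u; rewrite /Omega -/l1 -/l2 !expr0n /=.
    by congr (_ + _ / Num.sqrt _ - _ / Num.sqrt _ ^+ _ + _ / Num.sqrt _ ^+ _);
      ring.
  - rewrite !(mul0r, mulr0, addr0, subr0) mul1r.
    have -> : l2 = (r ^+ 2 - 3 * c) / r ^+ 5.
      apply: (mulIf (expf_neq0 5 r1)); rewrite divfK ?expf_neq0//.
      by move: rE; rewrite /rx_equation -/l2; lra.
    by field.
have Dy : dy (Omega m3 mu c) x 0 0 = 0.
  apply: (slice _ _ _ _ _ _ _ _ (lin _ _ _ (1 / 2 * l1) (1 / 2 * l2 * x ^+ 2)
              (sq 0))
            (lin _ _ _ 1 (x ^+ 2) (sq 0)) (lin _ _ _ 0 0 (sq 0))).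
  - by rewrite expr0n /= mul1r add0r.
  - apply/funext => u; rewrite /Omega -/l1 -/l2 !expr0n /=.
    by congr (_ + _ / Num.sqrt _ - _ / Num.sqrt _ ^+ _ + _ / Num.sqrt _ ^+ _);
      ring.
  - by rewrite !(mul0r, mulr0, addr0, subr0).
have Dz : dz (Omega m3 mu c) x 0 0 = 0.
  apply: (slice _ _ _ _ _ _ _ _ (lin _ _ _ (- (1 / 2)) (1 / 2 * l2 * x ^+ 2)
              (sq 0))
            (lin _ _ _ 1 (x ^+ 2) (sq 0)) (lin _ _ _ (3 * c) 0 (sq 0))).
  - by rewrite expr0n /= mul1r add0r.
  - apply/funext => u; rewrite /Omega -/l1 -/l2 !expr0n /=.
    by congr (_ + _ / Num.sqrt _ - _ / Num.sqrt _ ^+ _ + _ / Num.sqrt _ ^+ _);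
      ring.
  - by rewrite !(mul0r, mulr0, addr0, subr0).
apply/matrixP => i j; rewrite !mxE /= Dx Dy Dz.
by case: j => -[|[|[|[|[|[|//]]]]]] ? /=; rewrite ?mulr0 ?addr0 ?subr0.
Qed.

(* Main.v *)
(* On the axis r^-3 = lambda2 + 3 c r^-5, hence with c < 0
     Wxx = 3 lambda2 - 6 c r^-5 > 0,   Wyy = lambda1 - lambda2 = - 3 d,
     Wzz = - 1 - r^-3 + 9 c r^-5 < 0,  A = - 1/2 - 3/2 d + 6 c r^-5 < 0.
   Since c < 0 forces v <= 1, v^2 (4 - v^2) <= 3, while mu - mu^2 <= 1/4; so
   d > 0, B < 0 < D, and s^2 + A s + B has one negative and one positive root. *)
Require Import Defs.
From HB Require Import structures.
From mathcomp Require Import all_boot all_order all_algebra.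
From mathcomp Require Import all_classical all_reals all_analysis.
From mathcomp Require Import complex lra ring.

Set Implicit Arguments.
Unset Strict Implicit.
Unset Printing Implicit Defensive.

Import Order.TTheory GRing.Theory Num.Theory.
Import numFieldNormedType.Exports.

Local Open Scope ring_scope.

(** * Rules for differentials: locality and row-valued maps *)

Section Differentials.
Context {R : numFieldType} {V W : normedModType R}.

(** The first-order expansion of [g] at [x] is also one of [f], and the continuous linear part of
    such an expansion is unique. This allows closed forms of the partials of [Omega] that hold only
    away from the origin. *)
Lemma near_is_diff (f g df : V -> W) (x : V) :
  (\forall y \near x, f y = g y) -> is_diff x g df -> is_diff x f df.
Proof.
move=> fg dg; have fgx : f x = g x by exact: nbhs_singleton fg.
have dfE : f \o shift x = cst (f x) + 'd g x +o_ 0 id.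
  have /eqaddoP dgo := diff_locally (@ex_diff _ _ _ _ _ _ _ dg).
  apply/eqaddoP => e e0; move: fg; rewrite (near_shift 0) => fg.
  near=> h; rewrite !fctE fgx /=.
  have -> : f (h + x) = g (h + x).
    by near: h; move: fg; rewrite /= subr0.
  by near: h; exact: (dgo e e0).
have dgc : continuous ('d g x) by apply: diff_continuous; exact: ex_diff.
have dE : 'd f x = 'd g x :> (V -> W) by exact: diff_unique.
by split; [apply/diff_locallyP; rewrite dE|rewrite dE diff_val].
Unshelve. all: by end_near. Qed.

Lemma is_diff_coord m n (M : 'M[R]_(m, n)) i j :
  is_diff M (fun N : 'M[R]_(m, n) => N i j : R) (fun N => N i j).
Proof.
apply: DiffDef; first exact: differentiable_coord.
pose coord (N : 'M[R]_(m, n)) : R := N i j.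
have coord_lin : linear coord by move=> k A B; rewrite /coord !mxE.
pose coordM := GRing.isLinear.Build _ _ _ _ _ coord_lin.
pose f : {linear 'M[R]_(m, n) -> R} := HB.pack coord coordM.
by rewrite -[LHS]/('d f M : _ -> _) diff_lin //; exact: coord_continuous.
Qed.

(** A row is the sum of its entries times the basis rows, so the sum rule reduces the claim to
    scalar maps times a fixed vector. *)
Lemma is_diff_row n (F dF : 'I_n -> V -> R) (x : V) :
  (forall j, is_diff x (F j) (dF j)) ->
  is_diff x (fun s => \row_j F j s) (fun h => \row_j dF j h).
Proof.
move=> FdF.
have rowE (G : 'I_n -> V -> R) :
    (fun s => \row_j G j s) = \sum_(j < n) (fun s => G j s *: delta_mx 0 j).
  apply/funext => s; rewrite fct_sumE [LHS]row_sum_delta.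
  by apply: eq_bigr => j _; rewrite mxE.
rewrite !rowE.
elim/big_ind2 : _ => [|f df g dg fdf gdg|j _]; first exact: is_diff_cst.
  exact: is_diffD.
have Fj := FdF j; split; first exact/differentiableZl/ex_diff.
rewrite diffZl; last exact: ex_diff.
by rewrite diff_val.
Qed.

End Differentials.

Lemma jacobianE {R : numFieldType} m n (f df : 'rV[R]_m -> 'rV[R]_n) p :
  is_diff p f df -> forall i j, jacobian f p i j = df (delta_mx 0 i) 0 j.
Proof. by move=> fdf i j; rewrite mxE diff_val. Qed.

(** * Differentiating the force terms of the potential *)

Section Omega_derivatives.
Context {R : realType}.

Lemma is_diff_rsqrt (V : normedModType R) (Q dQ : V -> R) (p : V) :
  is_diff p Q dQ -> 0 < Q p ->
  is_diff p (fun s => (Num.sqrt (Q s))^-1)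
            (fun h => - (dQ h) / (2 * Num.sqrt (Q p) ^+ 3)).
Proof.
move=> QdQ Q0.
have S0 : Num.sqrt (Q p) != 0 by rewrite gt_eqF // sqrtr_gt0.
have D := is_deriveV S0 (is_derive1_sqrt Q0).
have dS : differentiable (fun t : R => (Num.sqrt t)^-1) (Q p).
  by apply/derivable1_diffP; exact: ex_derive.
split; first by apply: (differentiable_comp _ dS); exact: ex_diff.
have -> : (fun s => (Num.sqrt (Q s))^-1) = (fun t : R => (Num.sqrt t)^-1) \o Q.
  by [].
rewrite diff_comp //; apply/funext => h /=.
rewrite diff1E // derive1E derive_val diff_val /GRing.scale /=.
by field.
Qed.

(* Common shape of the three partial derivatives of Omega, with q for r^2. *)
Definition force (l k c u q z : R) : R :=
  u * (l - 1 / Num.sqrt q ^+ 3 + k / Num.sqrt q ^+ 5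
       - 15 * c * z ^+ 2 / Num.sqrt q ^+ 7).

(** At a point where [Z] vanishes the [z ^+ 2] term has zero differential; what remains is the
    variation of the factor [u] and that of [q]. *)
Lemma is_diff_force (l k c : R) (V : normedModType R)
    (U Q Z dU dQ dZ : V -> R) (p : V) :
  is_diff p U dU -> is_diff p Q dQ -> is_diff p Z dZ ->
  0 < Q p -> Z p = 0 ->
  let r := Num.sqrt (Q p) in
  is_diff p (fun s => force l k c (U s) (Q s) (Z s))
    (fun h => dU h * (l - 1 / r ^+ 3 + k / r ^+ 5)
              + U p * dQ h * (3 / (2 * r ^+ 5) - 5 * k / (2 * r ^+ 7))).
Proof.
move=> DU DQ DZ Q0 Z0 r.
have r0 : r != 0 by rewrite gt_eqF // sqrtr_gt0.
pose I s := (Num.sqrt (Q s))^-1.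
have DI : is_diff p I _ := is_diff_rsqrt DQ Q0.
have Ip : I p = r^-1 by [].
have IE s : (Num.sqrt (Q s))^-1 = I s by [].
(* From here on [I] is opaque: the product rules see only its differential [DI], its value [Ip] and
   the link [IE]. *)
clearbody I.
have DX n : is_diff p (I ^+ n.+1) _ := is_diffX n DI.
have DA : is_diff p (cst l - I ^+ 3 + k *: I ^+ 5) _ :=
  is_diffD (is_diffB (is_diff_cst l p) (DX 2)) (is_diffZ k (DX 4)).
have DB : is_diff p ((15 * c) *: (Z ^+ 2 * I ^+ 7)) _ :=
  is_diffZ (15 * c) (is_diffM (is_diffX 1 DZ) (DX 6)).
have D := is_diffM DU (is_diffB DA DB).
have -> : (fun s => force l k c (U s) (Q s) (Z s)) =
    U * (cst l - I ^+ 3 + k *: I ^+ 5 - (15 * c) *: (Z ^+ 2 * I ^+ 7)).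
  apply/funext => s /=; rewrite !fctE /force -!IE !exprVn mul1r.
  by rewrite /GRing.scale /= !mulrA.
apply: is_diff_eq D _; apply/funext => h; rewrite !fctE /= Z0 Ip -/r.
rewrite /GRing.scale /= -[(0 : V -> R) h]/(0 : R).
by field; exact: r0.
Qed.

(** * Gradient of [Omega] away from the origin *)

Section Partials.
Context {m3 mu c : R}.
Let W := Omega m3 mu c.

(** With two coordinates frozen, the quadratic part of [Omega], the squared radius and
    [3 * c * z ^+ 2] all have the shape [k * u ^+ 2 + m]. *)
Let affine_sq (t k m : R) :
  is_derive t 1 (fun u : R => k * u ^+ 2 + m) (k * (2 * t)).
Proof.
have -> : (fun u : R => k * u ^+ 2 + m) = k \*: (id ^+ 2) + cst m.
  by apply/funext => u; rewrite !fctE.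
by apply: is_derive_eq; rewrite addr0 /GRing.scale /= expr1 mulr1.
Qed.

Let slice (F P Q Z : R -> R) (t dP dQ dZ : R) :
  is_derive t 1 P dP -> is_derive t 1 Q dQ -> is_derive t 1 Z dZ ->
  0 < Q t ->
  F = (fun u => P u + 1 / Num.sqrt (Q u) - c / Num.sqrt (Q u) ^+ 3 +
            Z u / Num.sqrt (Q u) ^+ 5) ->
  let r := Num.sqrt (Q t) in
  derive1 F t = dP - dQ / (2 * r ^+ 3) + 3 * c * dQ / (2 * r ^+ 5) +
   dZ / r ^+ 5 - 5 * Z t * dQ / (2 * r ^+ 7).
Proof.
move=> DP DQ DZ Q0 -> r; rewrite derive1E.
exact: (@derive_val _ _ _ _ _ _ _ (is_derive_Omega_slice c DP DQ DZ Q0)).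
Qed.

Lemma dx_Omega (x y z : R) : let q := x ^+ 2 + y ^+ 2 + z ^+ 2 in
  0 < q -> dx W x y z = force (lambda2 m3 mu c) (3 * c) c x q z.
Proof.
move=> q q0; have r0 : Num.sqrt q != 0 by rewrite gt_eqF // sqrtr_gt0.
set l1 := lambda1 m3 mu c; set l2 := lambda2 m3 mu c.
have qE : 1 * x ^+ 2 + (y ^+ 2 + z ^+ 2) = q by rewrite /q; ring.
rewrite /dx (slice
  (affine_sq x (1 / 2 * l2) (1 / 2 * (l1 * y ^+ 2 - z ^+ 2)))
  (affine_sq x 1 (y ^+ 2 + z ^+ 2)) (affine_sq x 0 (3 * c * z ^+ 2))).
- by rewrite qE /force; field.
- by rewrite qE.
apply/funext => u; rewrite /W /Omega -/l1 -/l2.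
by congr (_ + _ / Num.sqrt _ - _ / Num.sqrt _ ^+ _ + _ / Num.sqrt _ ^+ _); ring.
Qed.

Lemma dy_Omega (x y z : R) : let q := x ^+ 2 + y ^+ 2 + z ^+ 2 in
  0 < q -> dy W x y z = force (lambda1 m3 mu c) (3 * c) c y q z.
Proof.
move=> q q0; have r0 : Num.sqrt q != 0 by rewrite gt_eqF // sqrtr_gt0.
set l1 := lambda1 m3 mu c; set l2 := lambda2 m3 mu c.
have qE : 1 * y ^+ 2 + (x ^+ 2 + z ^+ 2) = q by rewrite /q; ring.
rewrite /dy (slice
  (affine_sq y (1 / 2 * l1) (1 / 2 * (l2 * x ^+ 2 - z ^+ 2)))
  (affine_sq y 1 (x ^+ 2 + z ^+ 2)) (affine_sq y 0 (3 * c * z ^+ 2))).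
- by rewrite qE /force; field.
- by rewrite qE.
apply/funext => u; rewrite /W /Omega -/l1 -/l2.
by congr (_ + _ / Num.sqrt _ - _ / Num.sqrt _ ^+ _ + _ / Num.sqrt _ ^+ _); ring.
Qed.

(** The coefficient 9c is 3c from the radial term -c/r^3 plus 6c from the numerator of 3cz^2/r^5. *)
Lemma dz_Omega (x y z : R) : let q := x ^+ 2 + y ^+ 2 + z ^+ 2 in
  0 < q -> dz W x y z = force (- 1) (9 * c) c z q z.
Proof.
move=> q q0; have r0 : Num.sqrt q != 0 by rewrite gt_eqF // sqrtr_gt0.
set l1 := lambda1 m3 mu c; set l2 := lambda2 m3 mu c.
have qE : 1 * z ^+ 2 + (x ^+ 2 + y ^+ 2) = q by rewrite /q; ring.
rewrite /dz (slice
  (affine_sq z (- (1 / 2)) (1 / 2 * (l2 * x ^+ 2 + l1 * y ^+ 2)))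
  (affine_sq z 1 (x ^+ 2 + y ^+ 2)) (affine_sq z (3 * c) 0)).
- by rewrite qE /force; field.
- by rewrite qE.
apply/funext => u; rewrite /W /Omega -/l1 -/l2.
by congr (_ + _ / Num.sqrt _ - _ / Num.sqrt _ ^+ _ + _ / Num.sqrt _ ^+ _); ring.
Qed.

(** * Differential of the gradient at a point of the x-axis *)

Section Axis.
Context {V : normedModType R} {X Y Z dX dY dZ : V -> R} {p : V}.
Context (DX : is_diff p X dX) (DY : is_diff p Y dY) (DZ : is_diff p Z dZ).
Context (X0 : X p != 0) (Y0 : Y p = 0) (Z0 : Z p = 0).
Let r := `|X p|.
Let Q (s : V) := X s ^+ 2 + Y s ^+ 2 + Z s ^+ 2.

Let Qp : Q p = X p ^+ 2.
Proof. by rewrite /Q Y0 Z0 expr0n /= !addr0. Qed.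

Let Qp_gt0 : 0 < Q p.
Proof. by rewrite Qp exprn_even_gt0. Qed.

Let sqrt_Qp : Num.sqrt (Q p) = r.
Proof. by rewrite Qp sqrtr_sqr. Qed.

Let r0 : r != 0.
Proof. by rewrite normr_eq0. Qed.

Let DQ : is_diff p Q (fun h => 2 * X p * dX h).
Proof.
have -> : Q = X ^+ 2 + Y ^+ 2 + Z ^+ 2 by apply/funext => s; rewrite !fctE.
apply: is_diff_eq (is_diffD (is_diffD (is_diffX 1 DX) (is_diffX 1 DY))
  (is_diffX 1 DZ)) _.
apply/funext => h; rewrite !fctE /= Y0 Z0.
by rewrite /GRing.scale /=; ring.
Qed.

(** The closed forms of the gradient require r^2 > 0, which by continuity persists near [p]. *)
Let near_Q : \forall s \near p, 0 < Q s.
Proof.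
have /differentiable_continuous Qc : differentiable Q p by exact: ex_diff.
exact: cvgr_gt Qc _ Qp_gt0.
Qed.

(** Coordinates are arbitrary maps [X], [Y], [Z], so that one computation gives both the second
    partials ([p] real) and the Jacobian ([p] a state). The variation of r adds 3/r^3 - 15c/r^5 to
    the factor lambda2 - 1/r^3 + 3c/r^5. *)
Lemma is_diff_dx_axis :
  is_diff p (fun s => dx W (X s) (Y s) (Z s))
    (fun h => (lambda2 m3 mu c + 2 / r ^+ 3 - 12 * c / r ^+ 5) * dX h).
Proof.
apply: (near_is_diff
  (g := fun s => force (lambda2 m3 mu c) (3 * c) c (X s) (Q s) (Z s))).
  by near=> s; rewrite dx_Omega //; near: s; exact: near_Q.
have := is_diff_force (lambda2 m3 mu c) (3 * c) c DX DQ DZ Qp_gt0 Z0.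
rewrite /= sqrt_Qp => DF; apply: is_diff_eq; apply/funext => h.
(* [X p] enters only through its square, so both signs of x give the same coefficient. *)
have rr : X p * (2 * X p * dX h) = 2 * r ^+ 2 * dX h.
  by rewrite /r real_normK ?num_real //; ring.
by rewrite rr; field.
Unshelve. all: by end_near. Qed.

(** The variation of r is multiplied by [Y p = 0], so only [dY] survives and the mixed derivatives
    vanish. *)
Lemma is_diff_dy_axis :
  is_diff p (fun s => dy W (X s) (Y s) (Z s))
    (fun h => (lambda1 m3 mu c - 1 / r ^+ 3 + 3 * c / r ^+ 5) * dY h).
Proof.
apply: (near_is_diff
  (g := fun s => force (lambda1 m3 mu c) (3 * c) c (Y s) (Q s) (Z s))).
  by near=> s; rewrite dy_Omega //; near: s; exact: near_Q.
have := is_diff_force (lambda1 m3 mu c) (3 * c) c DY DQ DZ Qp_gt0 Z0.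
rewrite /= sqrt_Qp Y0 => DF; apply: is_diff_eq; apply/funext => h.
by rewrite !mul0r addr0 mulrC.
Unshelve. all: by end_near. Qed.

Lemma is_diff_dz_axis :
  is_diff p (fun s => dz W (X s) (Y s) (Z s))
    (fun h => (- 1 - 1 / r ^+ 3 + 9 * c / r ^+ 5) * dZ h).
Proof.
apply: (near_is_diff (g := fun s => force (- 1) (9 * c) c (Z s) (Q s) (Z s))).
  by near=> s; rewrite dz_Omega //; near: s; exact: near_Q.
have := is_diff_force (- 1) (9 * c) c DZ DQ DZ Qp_gt0 Z0.
rewrite /= sqrt_Qp Z0 => DF; apply: is_diff_eq; apply/funext => h.
by rewrite !mul0r addr0 mulrC.
Unshelve. all: by end_near. Qed.

End Axis.
End Partials.
End Omega_derivatives.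

(** * Determinant of the characteristic matrix *)

(* Indexing entries by nat lets sparse determinants be expanded by evaluation. *)
Fixpoint laplace {R : pzRingType} n (F : nat -> nat -> R) : R :=
  if n is n'.+1 then
    foldr (fun j s => F 0%N j *
      ((-1) ^+ j * laplace n' (fun i k => F i.+1 (bump j k))) + s) 0 (iota 0 n)
  else 1.

Lemma det_laplace {R : comPzRingType} n (F : nat -> nat -> R) :
  \det (\matrix_(i < n, j < n) F i j) = laplace n F.
Proof.
elim: n F => [|n IHn] F; first by rewrite det_mx00.
rewrite [RHS](_ : _ = \sum_(0 <= j < n.+1) F 0%N j *
    ((-1) ^+ j * laplace n (fun i k => F i.+1 (bump j k)))); last first.
  by rewrite unlock /index_iota subn0.
rewrite big_mkord (expand_det_row _ ord0); apply: eq_bigr => j _.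
rewrite mxE /cofactor add0n -IHn; congr (_ * (_ * \det _)).
by apply/matrixP => i k; rewrite !mxE.
Qed.

(** Used to expand one row at a time, so that zero entries are discarded before their minors are
    expanded. *)
Lemma laplaceS {R : pzRingType} n (F : nat -> nat -> R) :
  laplace n.+1 F = foldr (fun j s => F 0%N j *
      ((-1) ^+ j * laplace n (fun i k => F i.+1 (bump j k))) + s)
    0 (iota 0 n.+1).
Proof. by []. Qed.

Lemma laplace0 {R : pzRingType} (F : nat -> nat -> R) : laplace 0 F = 1.
Proof. by []. Qed.

Arguments laplace : simpl never.

(** Entries of xI - M for the transposed Jacobian M at an axis point, with a, b, e in place of the
    second derivatives along x, y, z. *)
Definition hill_char_entry {R : pzRingType} (x a b e : R) (i j : nat) : R :=
  nth 0 (nth [::] [:: [:: x; 0; 0; - a; 0; 0];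
                      [:: 0; x; 0; 0; - b; 0];
                      [:: 0; 0; x; 0; 0; - e];
                      [:: -1; 0; 0; x; 2; 0];
                      [:: 0; -1; 0; -2; x; 0];
                      [:: 0; 0; -1; 0; 0; x]] i) j.

(** The vertical motion (indices 2 and 5) decouples from the planar one, whence the two factors. The
    general ring allows [x] to be the indeterminate of a polynomial ring. *)
Lemma det_hill {R : comPzRingType} (x a b e : R) :
  \det (\matrix_(i < 6, j < 6) hill_char_entry x a b e i j) =
    (x ^+ 2 - e) * (x ^+ 4 + (4 - a - b) * x ^+ 2 + a * b).
Proof.
rewrite det_laplace /hill_char_entry.
do 6 rewrite !laplaceS /= !(mul0r, addr0, add0r).
rewrite !laplace0 /bump /= !(mulr0, addr0).
by ring.
Qed.

(** * From factors in the squared eigenvalue to eigenvalue pairs *)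

Lemma mul_XsubC_opp {R : comNzRingType} (z : R) :
  ('X - z%:P) * ('X - (- z)%:P) = 'X^2 - (z ^+ 2)%:P.
Proof. by rewrite polyCN opprK -subr_sqr rmorphXn. Qed.

(** Over the complex numbers each factor X^2 - w splits with two opposite roots: imaginary for w <
    0, real for w > 0. *)
Lemma center_center_saddle_char_poly {R : realType}
    (M : 'M[R]_6) (e s1 s2 : R) :
  char_poly M = ('X^2 - e%:P) * ('X^2 - s1%:P) * ('X^2 - s2%:P) ->
  e < 0 -> s1 < 0 -> 0 < s2 -> center_center_saddle M.
Proof.
move=> ME e0 s10 s20.
pose im w : R[i] := (0 +i* Num.sqrt (- w))%C.
have imK w : w < 0 -> im w ^+ 2 = w%:C%C.
  move=> w0; rewrite /im expr2 /GRing.mul /= !mul0r mulr0 addr0 sub0r -expr2.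
  by rewrite sqr_sqrtr ?opprK // oppr_ge0 ltW.
have imN w : - im w = (0 +i* - Num.sqrt (- w))%C.
  by rewrite /im /GRing.opp /= oppr0.
have im_center w : w < 0 -> center_pair (im w) (- im w).
  move=> w0; exists (Num.sqrt (- w)); last by rewrite imN.
  by rewrite gt_eqF // sqrtr_gt0 oppr_gt0.
pose re : R[i] := (Num.sqrt s2)%:C%C.
exists (im e), (- im e), (im s1), (- im s1), re, (- re); split; first last.
- exists (Num.sqrt s2), (- Num.sqrt s2); split => //.
  + by rewrite sqrtr_gt0.
  + by rewrite oppr_lt0 sqrtr_gt0.
  + by rewrite /re /real_complex_def /GRing.opp /= oppr0.
- exact: im_center.
- exact: im_center.
rewrite !big_cons big_nil mulr1 -map_char_poly ME.
transitivity (('X - (im e)%:P) * ('X - (- im e)%:P) *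
  (('X - (im s1)%:P) * ('X - (- im s1)%:P)) *
  (('X - re%:P) * ('X - (- re)%:P))); last by rewrite !mulrA.
rewrite !mul_XsubC_opp !imK //.
have -> : re ^+ 2 = s2%:C%C by rewrite /re -rmorphXn /= sqr_sqrtr // ltW.
by rewrite !rmorphM !rmorphB /= !map_polyXn !map_polyC.
Qed.

(** * Jacobian at an axis point and its characteristic polynomial *)

Section Linearization.
Context {R : realType} (m3 mu c x : R) (x0 : x != 0).
Let W := Omega m3 mu c.
Let r := `|x|.

Lemma Omega_xx_axis :
  dx (dx W) x 0 0 = lambda2 m3 mu c + 2 / r ^+ 3 - 12 * c / r ^+ 5.
Proof.
have D := is_diff_dx_axis (m3 := m3) (mu := mu) (c := c) (is_diff_id x)
  (is_diff_cst 0 x) (is_diff_cst 0 x) x0 erefl erefl.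
by rewrite {1}/dx derive1E' ?(@diff_val _ _ _ _ _ _ _ D) ?mulr1.
Qed.

Lemma Omega_yy_axis :
  dy (dy W) x 0 0 = lambda1 m3 mu c - 1 / r ^+ 3 + 3 * c / r ^+ 5.
Proof.
have D := is_diff_dy_axis (m3 := m3) (mu := mu) (c := c) (is_diff_cst x 0)
  (is_diff_id 0) (is_diff_cst 0 0) x0 erefl erefl.
by rewrite {1}/dy derive1E' ?(@diff_val _ _ _ _ _ _ _ D) ?mulr1.
Qed.

Lemma Omega_zz_axis : dz (dz W) x 0 0 = - 1 - 1 / r ^+ 3 + 9 * c / r ^+ 5.
Proof.
have D := is_diff_dz_axis (m3 := m3) (mu := mu) (c := c) (is_diff_cst x 0)
  (is_diff_cst 0 0) (is_diff_id 0) x0 erefl erefl.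
by rewrite {1}/dz derive1E' ?(@diff_val _ _ _ _ _ _ _ D) ?mulr1.
Qed.

Let a := dx (dx W) x 0 0.
Let b := dy (dy W) x 0 0.
Let e := dz (dz W) x 0 0.

(** Since the mixed derivatives vanish on the axis, each acceleration depends to first order on its
    own coordinate and on the Coriolis term. *)
Lemma is_diff_hill_field_axis :
  is_diff (x_axis_state x) (hill_field m3 mu c)
    (fun h => \row_(j < 6) [:: h 0 3; h 0 4; h 0 5; a * h 0 0 + 2 * h 0 4;
                               b * h 0 1 - 2 * h 0 3; e * h 0 2]`_j).
Proof.
pose p := x_axis_state x.
have p0 : p 0 0 != 0 by rewrite mxE.
have p1 : p 0 1 = 0 by rewrite mxE.
have p2 : p 0 2 = 0 by rewrite mxE.
have pr : `|p 0 0| = r by rewrite mxE.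
have D (j : 'I_6) := is_diff_coord p 0 j.
have Da := is_diff_dx_axis (m3 := m3) (mu := mu) (c := c)
  (D 0) (D 1) (D 2) p0 p1 p2.
have Db := is_diff_dy_axis (m3 := m3) (mu := mu) (c := c)
  (D 0) (D 1) (D 2) p0 p1 p2.
have De := is_diff_dz_axis (m3 := m3) (mu := mu) (c := c)
  (D 0) (D 1) (D 2) p0 p1 p2.
rewrite pr -Omega_xx_axis in Da; rewrite pr -Omega_yy_axis in Db.
rewrite pr -Omega_zz_axis in De.
apply: is_diff_row => -[[|[|[|[|[|[|//]]]]]] ?] /=; do ?exact: D.
- exact: is_diffD Da (is_diffZ 2 (D 4)).
- exact: is_diffB Db (is_diffZ 2 (D 3)).
- exact: De.
Qed.

Lemma linearizationE :
  linearization m3 mu c (x_axis_state x) =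
  \matrix_(i < 6, j < 6)
    (nth [::] [:: [:: 0; 0; 0; a; 0; 0];
                  [:: 0; 0; 0; 0; b; 0];
                  [:: 0; 0; 0; 0; 0; e];
                  [:: 1; 0; 0; 0; -2; 0];
                  [:: 0; 1; 0; 2; 0; 0];
                  [:: 0; 0; 1; 0; 0; 0]] i)`_j.
Proof.
apply/matrixP => i j; rewrite (jacobianE is_diff_hill_field_axis) !mxE.
case: i => -[|[|[|[|[|[|//]]]]]] ?; case: j => -[|[|[|[|[|[|//]]]]]] ?;
  by rewrite /= ?mxE /= ?(mulr0, mulr1, addr0, add0r, subr0, sub0r, oppr0).
Qed.

Lemma char_poly_linearization :
  char_poly (linearization m3 mu c (x_axis_state x)) =
    ('X^2 - e%:P) * ('X^4 + (4 - a - b)%:P * 'X^2 + (a * b)%:P).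
Proof.
rewrite linearizationE.
(* Constants are pushed into the polynomial ring so that [det_hill] applies with [x] equal to
   ['X]. *)
rewrite !polyCB polyC_natr polyCM -det_hill.
congr (\det _); apply/matrixP => i j; rewrite !mxE.
case: i => -[|[|[|[|[|[|//]]]]]] ?; case: j => -[|[|[|[|[|[|//]]]]]] ?;
  by rewrite /= ?polyCN ?polyC1 ?polyC_natr
       ?(mulr0n, mulr1n, polyC0, subr0, sub0r, opprK).
Qed.

End Linearization.

(** * Signs of the second derivatives and the stability type *)

Lemma hill_d_gt0 {R : realType} (m3 mu c : R) :
  c < 0 -> 0 < mu <= 1 / 2 -> 0 < hill_d m3 mu c.
Proof.
move=> c0 /andP[mu0 mu1].
have [v0 v1] : 0 <= hill_v m3 c /\ hill_v m3 c <= 1.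
  split; first exact: powR_ge0.
  have m0 := powR_ge0 m3 (2 / 3).
  have : 1 <= 1 - 3 * m3 `^ (2 / 3) * c by nra.
  set t := 1 - _ => t1.
  (* Writing 1 as t^0 turns v <= 1 into monotonicity in the exponent: t >= 1 and -1/3 <= 0. *)
  by rewrite /hill_v -/t -[leRHS](powRr0 t) ler_powR // oppr_le0 divr_ge0.
rewrite /hill_d sqrtr_gt0; set v := hill_v m3 c in v0 v1 *.
have [w wE] : exists w, w = v ^+ 2 by eexists.
rewrite -!wE.
have w0 : 0 <= w by rewrite wE sqr_ge0.
have w1 : w <= 1 by rewrite wE exprn_ile1.
(* This is (1 - w)(3 - w) >= 0. With the bounds on [mu - mu ^+ 2] the subtracted product is at most
   3/4, so the radicand is at least 1/4. *)
have : w * (4 - w) <= 3 by nra.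
have : mu - mu ^+ 2 <= 1 / 4 by nra.
have : 0 <= mu - mu ^+ 2 by nra.
by nra.
Qed.

Theorem proposition4p4 (R : realType) (m3 : R) (hm3 : 0 < m3 < 1) :
  exists2 c0 : R, 0 < c0 &
    forall mu c r x : R,
      0 < mu <= 1 / 2 -> - c0 < c < 0 ->
      0 < r -> rx_equation m3 mu c r ->
      x = r \/ x = - r ->
      let W := Omega m3 mu c in
      let Wxx := dx (dx W) x 0 0 in
      let Wyy := dy (dy W) x 0 0 in
      let Wzz := dz (dz W) x 0 0 in
      let A := 4 - Wxx - Wyy in
      let B := Wxx * Wyy in
      let D := A ^+ 2 - 4 * B in
      [/\ Wzz < 0, A < 0, B < 0, 0 < D &
          center_center_saddle (linearization m3 mu c (x_axis_state x))].
Proof.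
(* The value [1] is an arbitrary choice: the signs below come from [c < 0]. *)
exists 1 => // mu c r x mu_bounds /andP[_ c0] r0 rE xr W Wxx Wyy Wzz A B D.
have x0 : x != 0 by case: xr => ->; rewrite ?oppr_eq0 gt_eqF.
have xN : `|x| = r by case: xr => ->; rewrite ?normrN gtr0_norm.
have d0 := hill_d_gt0 m3 c0 mu_bounds.
have r1 : r != 0 by rewrite gt_eqF.
have cr0 : c / r ^+ 5 < 0 by rewrite pmulr_llt0 // invr_gt0 exprn_gt0.
have r30 : 0 < 1 / r ^+ 3 by rewrite divr_gt0 // exprn_gt0.
(* This is the equilibrium equation divided by r^5; it eliminates r^-3 from [Wxx] and [Wyy]. *)
have rxE : 1 / r ^+ 3 = lambda2 m3 mu c + 3 * (c / r ^+ 5).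
  apply: (mulIf (expf_neq0 5 r1)).
  rewrite mulrDl -mulrA -(mulrA 3) divfK ?expf_neq0 //.
  have -> : r ^- 3 * r ^+ 5 = r ^+ 2 by field.
  by move: rE; rewrite /rx_equation; lra.
have WxxE : Wxx = 9 / 2 * (1 + hill_d m3 mu c) - 6 * (c / r ^+ 5).
  rewrite /Wxx Omega_xx_axis // xN; move: rxE; rewrite /lambda2 -!mulrA.
  by set y := r ^- 3; set z := c * _; lra.
have WyyE : Wyy = - 3 * hill_d m3 mu c.
  rewrite /Wyy Omega_yy_axis // xN; move: rxE.
  rewrite /lambda1 /lambda2 -!mulrA.
  by set y := r ^- 3; set z := c * _; lra.
have WzzE : Wzz = - 1 - 1 / r ^+ 3 + 9 * (c / r ^+ 5).
  by rewrite /Wzz Omega_zz_axis // xN -!mulrA.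
have Wzz0 : Wzz < 0 by rewrite WzzE; lra.
have Wxx0 : 0 < Wxx by rewrite WxxE; lra.
have Wyy0 : Wyy < 0 by rewrite WyyE; lra.
have A0 : A < 0 by rewrite /A WxxE WyyE; lra.
have B0 : B < 0 by rewrite pmulr_rlt0.
have D0 : 0 < D by rewrite /D; have := sqr_ge0 A; lra.
split => //.
have sD : Num.sqrt D ^+ 2 = D by rewrite sqr_sqrtr // ltW.
have sD0 : 0 < Num.sqrt D by rewrite sqrtr_gt0.
set t := Num.sqrt D in sD sD0.
(* These are the roots of s^2 + A s + B, where s is the square of a planar eigenvalue. Afterwards
   only their sum, their product and the sign of [s2] are kept. *)
pose s1 := (- A - t) / 2; pose s2 := (- A + t) / 2.
have s1s2 : s1 * s2 = B.
  by rewrite /s1 /s2; have := sD; rewrite /D; nra.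
have s12 : s1 + s2 = - A by rewrite /s1 /s2; field.
have s20 : 0 < s2 by rewrite /s2; lra.
clearbody s1 s2.
apply: (@center_center_saddle_char_poly _ _ Wzz s1 s2) => //.
  rewrite char_poly_linearization // -/W -/Wxx -/Wyy -/Wzz -/A -/B -s1s2.
  have -> : A = - (s1 + s2) by rewrite s12 opprK.
  by rewrite polyCN polyCD polyCM; ring.
(* [s1] is negative because [s2] is positive and their product [B] is negative. *)
by rewrite -(pmulr_llt0 _ s20) s1s2.
Qed.
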